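(* Consider, for each tail (sign $-$ for lower, $+$ for upper), the one-sided adaptive conformal inference (ACI) recursion with target level $\alpha^\pm\in(0,1)$, step size $\gamma>0$ and initial level $\alpha_1^\pm\in[0,1]$: $$\alpha^\pm_{i+1}=\alpha_i^\pm+\gamma\,(\alpha^\pm-\mathrm{err}_i^\pm),\qquad \mathrm{err}_i^-=\mathbf 1\{Y_i\notin\mathcal C^{L}_{i,\alpha_i^-}\},\quad \mathrm{err}_i^+=\mathbf 1\{Y_i\notin\mathcal C^{U}_{i,\alpha_i^+}\},\qquad i\ge1.$$ Assume that the empirical quantile functions $\widehat Q^{L}_i,\widehat Q^{U}_i$ used to build the one-sided prediction sets are non-decreasing, with $\widehat Q^{L}_i(x)=\widehat Q^{U}_i(x)=-\infty$ for $x<0$ and $\widehat Q^{L}_i(x)=\widehat Q^{U}_i(x)=+\infty$ for $x>1$. No assumption (in particular no exchangeability) is made on the distribution of the data sequence. Then, for each sign, with probability one, for all $N\in\mathbb N$ ($N\ge1$), $$\left|\frac1N\sum_{i=1}^N\mathrm{err}_i^\pm-\alpha^\pm\right|\le\frac{\max\{\alpha_1^\pm,1-\alpha_1^\pm\}+\gamma}{N\gamma}.$$ In particular, $\frac1N\sum_{i=1}^N\mathrm{err}_i^\pm\to\alpha^\pm$ almost surely as $N\to\infty$.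
   Context: The online data are an arbitrary sequence of random pairs $(X_i,Y_i)_{i\ge1}$ with $X_i\in\mathbb R^p$, $Y_i\in\mathbb R$ (indexed from $1$ after an initial sample used for initialization). At each time $i$, from past data one has real-valued lower and upper conformity score functions $s_i^L(x,y)$, $s_i^U(x,y)$ and corresponding empirical quantile functions $\widehat Q_i^L,\widehat Q_i^U:\mathbb R\to[-\infty,+\infty]$ (of calibration scores). For $a\in\mathbb R$, the one-sided prediction sets at miscoverage level $a$ are $$\mathcal C^{L}_{i,a}=\{y\in\mathbb R: s_i^L(X_i,y)\le\widehat Q_i^L(1-a)\},\qquad \mathcal C^{U}_{i,a}=\{y\in\mathbb R: s_i^U(X_i,y)\le\widehat Q_i^U(1-a)\}.$$ The set $\mathcal C^L$ is a lower-bounded interval of the form $[L,\infty)$ and $\mathcal C^U$ an upper-bounded one $(-\infty,U]$ (possibly degenerate: equal to $\mathbb R$ or empty). An expression with $\pm$ is a pair of statements, one for each sign. *)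

(* Defs.v *)
From HB Require Import structures.
From mathcomp Require Import all_boot all_order all_algebra.
From mathcomp Require Import all_classical all_reals all_analysis.

Set Implicit Arguments.
Unset Strict Implicit.
Unset Printing Implicit Defensive.

Import Order.TTheory GRing.Theory Num.Theory.
Import numFieldNormedType.Exports.

Local Open Scope classical_set_scope.
Local Open Scope ring_scope.

(* R^p is [p.-tuple R], which carries the product sigma-algebra. *)
Definition observation (R : realType) (p : nat) : Type := (p.-tuple R * R)%type.

(* A rule fits, at time i and from the list of past observations, a conformity
   score (x, y) |-> s_i(x, y), resp. an empirical quantile function. *)
Definition score_rule (R : realType) (p : nat) : Type :=
  nat -> seq (observation R p) -> p.-tuple R -> R -> R.

Definition quantile_rule (R : realType) (p : nat) : Type :=
  nat -> seq (observation R p) -> R -> \bar R.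

Section OnlineConformal.
Variables (R : realType) (p : nat) (T : Type).

(* Data available when predicting at time i: the initial sample, of size n0,
   followed by the online observations 1, ..., i - 1. *)
Definition past_data (n0 : nat)
    (X0 : 'I_n0 -> T -> p.-tuple R) (Y0 : 'I_n0 -> T -> R)
    (X : nat -> T -> p.-tuple R) (Y : nat -> T -> R)
    (i : nat) (w : T) : seq (observation R p) :=
  [seq (X0 k w, Y0 k w) | k <- enum 'I_n0] ++
  [seq (X j w, Y j w) | j <- iota 1 i.-1].

Definition prediction_set (s : score_rule R p) (Q : quantile_rule R p)
    (past : nat -> T -> seq (observation R p)) (X : nat -> T -> p.-tuple R)
    (i : nat) (w : T) (a : R) : set R :=
  [set y : R | ((s i (past i w) (X i w) y)%:E <= Q i (past i w) (1 - a)%R)%E].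

(* The infinite endpoints give the degenerate cases: the whole line and the
   empty set. *)
Definition lower_bounded_interval (C : set R) : Prop :=
  exists l : \bar R, C = [set y : R | (l <= y%:E)%E].

Definition upper_bounded_interval (C : set R) : Prop :=
  exists u : \bar R, C = [set y : R | (y%:E <= u)%E].

Definition quantile_convention (q : R -> \bar R) : Prop :=
  [/\ nondecreasing_fun q,
      forall x : R, x < 0 -> q x = -oo%E
    & forall x : R, 1 < x -> q x = +oo%E].

Variables (C : nat -> T -> R -> set R) (Y : nat -> T -> R).

Definition err (alpha : nat -> T -> R) (i : nat) (w : T) : R :=
  \1_(~` C i w (alpha i w)) (Y i w).

(* Time starts at 1; the value [alpha 0] is unconstrained and never used. *)
Definition aci_recursion (target gamma alpha1 : R) (alpha : nat -> T -> R) :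
    Prop :=
  (forall w : T, alpha 1 w = alpha1) /\
  (forall (i : nat) (w : T), (1 <= i)%N ->
     alpha i.+1 w = alpha i w + gamma * (target - err alpha i w)).

Definition mean_err (alpha : nat -> T -> R) (N : nat) (w : T) : R :=
  N%:R^-1 * \sum_(1 <= i < N.+1) err alpha i w.

End OnlineConformal.

(* Main.v *)
(** The bound is pathwise. A negative level yields the whole line, hence no
    error, and a level above 1 yields the empty set, hence an error; since one
    step moves the level by at most [gamma], it never leaves
    [[-gamma, 1 + gamma]]. Summing the recursion,
    [alpha_(N+1) - alpha_1 = gamma (N target - sum of the errors)], and the
    left-hand side is at most [max (alpha_1, 1 - alpha_1) + gamma] in absolute
    value. *)
Require Import Defs.
From HB Require Import structures.
From mathcomp Require Import all_boot all_order all_algebra.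
From mathcomp Require Import all_classical all_reals all_analysis.
From mathcomp Require Import ring lra.

Set Implicit Arguments.
Unset Strict Implicit.
Unset Printing Implicit Defensive.

Import Order.TTheory GRing.Theory Num.Theory.
Import numFieldNormedType.Exports.

Local Open Scope classical_set_scope.
Local Open Scope ring_scope.

Section Recursion.
Variables (R : realFieldType) (target gamma : R) (a e : nat -> R).
Hypothesis gamma_gt0 : 0 < gamma.
Hypothesis target_01 : 0 < target < 1.
Hypothesis a1_01 : 0 <= a 1 <= 1.
Hypothesis e_01 : forall i, 0 <= e i <= 1.
Hypothesis e_lt0 : forall i, (1 <= i)%N -> a i < 0 -> e i = 0.
Hypothesis e_gt1 : forall i, (1 <= i)%N -> 1 < a i -> e i = 1.
Hypothesis a_rec :
  forall i, (1 <= i)%N -> a i.+1 = a i + gamma * (target - e i).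

(** From a level in [[0, 1]] one step moves by at most [gamma], since [target] and [e i] both lie in
    [[0, 1]]. Outside [[0, 1]] the forced value of [e] makes the step point back towards the
    interval, so an overshoot never grows. *)
Lemma recursion_bounded (i : nat) : - gamma <= a i.+1 <= 1 + gamma.
Proof.
(* The shift to [i.+1] starts the induction at [a 1]; [a 0] is unconstrained. *)
elim: i => [|i IH]; first by have := gamma_gt0; have := a1_01; lra.
rewrite a_rec //; have [a0|a0] := ltP (a i.+1) 0.
  by rewrite e_lt0 //; have := gamma_gt0; have := target_01; nra.
have [a1|a1] := ltP 1 (a i.+1).
  by rewrite e_gt1 //; have := gamma_gt0; have := target_01; nra.
have /andP[e0 e1] := e_01 i.+1.
by have := gamma_gt0; have := target_01; nra.
Qed.

Lemma recursion_telescope (N : nat) :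
  a N.+1 - a 1 = gamma * (N%:R * target - \sum_(1 <= i < N.+1) e i).
Proof.
elim: N => [|N IH]; first by rewrite big_geq // mul0r !subrr mulr0.
by rewrite a_rec // big_nat_recr //= -natr1; move: IH; lra.
Qed.

Lemma recursion_mean_bound (N : nat) : (1 <= N)%N ->
  `|N%:R^-1 * (\sum_(1 <= i < N.+1) e i) - target| <=
  (Num.max (a 1) (1 - a 1) + gamma) / (N%:R * gamma).
Proof.
move=> N1; have N0 : 0 < N%:R :> R by rewrite ltr0n.
(* The telescoped identity divided by [N%:R * gamma], with the sign reversed. *)
have -> : N%:R^-1 * (\sum_(1 <= i < N.+1) e i) - target =
    (a 1 - a N.+1) / (N%:R * gamma).
  rewrite -(opprB (a N.+1)) recursion_telescope; field.
  by rewrite !gt_eqF.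
have D0 : 0 < N%:R * gamma by rewrite mulr_gt0.
rewrite normrM normfV (gtr0_norm D0) ler_pM2r ?invr_gt0// ler_norml.
(* Both sides of the maximum serve: [a 1 - a N.+1] is at most [a 1 + gamma] and at least
   [- (1 - a 1 + gamma)]. *)
have := recursion_bounded N.
have : a 1 <= Num.max (a 1) (1 - a 1) by rewrite le_max lexx.
have : 1 - a 1 <= Num.max (a 1) (1 - a 1) by rewrite le_max lexx orbT.
by lra.
Qed.

End Recursion.

Lemma cvg_dist_le_div_nat (R : realType) (u : nat -> R) (l c : R) :
  (forall N, (1 <= N)%N -> `|u N - l| <= c / N%:R) ->
  u N @[N --> \oo] --> l.
Proof.
move=> ul; apply/cvgrPdistC_le => eps eps0; near=> N.
have N1 : (1 <= N)%N by near: N; exists 1%N.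
(* The condition [c / N%:R <= eps] becomes [c / eps <= N%:R], true for all large [N]. *)
rewrite (le_trans (ul _ N1))// ler_pdivrMr ?ltr0n// mulrC -ler_pdivrMr//.
by near: N; exact: nbhs_infty_ger.
Unshelve. all: by end_near. Qed.

Section OneSidedACI.
Variables (R : realType) (p : nat) (T : Type).
Variables (s : score_rule R p) (Q : quantile_rule R p).
Variables (past : nat -> T -> seq (observation R p)).
Variables (X : nat -> T -> p.-tuple R) (Y : nat -> T -> R).
Hypothesis hQ : forall (i : nat) (w : T), (1 <= i)%N ->
  quantile_convention (Q i (past i w)).
Variables (gamma target alpha1 : R) (alpha : nat -> T -> R).
Hypothesis gamma_gt0 : 0 < gamma.
Hypothesis target_01 : 0 < target < 1.
Hypothesis alpha1_01 : 0 <= alpha1 <= 1.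
Local Notation C := (prediction_set s Q past X).
Hypothesis hrec : aci_recursion C Y target gamma alpha1 alpha.

(** Once [w] is fixed, levels and errors are deterministic sequences; the convention on the
    quantiles forces the errors at levels outside [[0, 1]]. *)
Lemma aci_mean_err_bound (w : T) (N : nat) : (1 <= N)%N ->
  `|mean_err C Y alpha N w - target| <=
  (Num.max alpha1 (1 - alpha1) + gamma) / (N%:R * gamma).
Proof.
case: hrec => a1 arec; rewrite -(a1 w) => N1.
apply: (@recursion_mean_bound R target gamma (alpha ^~ w)
  (fun i => err C Y alpha i w)) => //=.
- by rewrite a1.
- by move=> i; rewrite /err indicE; case: (_ \in _); rewrite ?ler01 ?lexx.
(* For a negative level, [1 - alpha i w] exceeds 1, so the threshold is [+oo] and every outcome is
   covered. *)
- move=> i i1 a0; rewrite /err indicE memNset//= => /(_ _); apply.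
  have [_ _ q1] := hQ w i1.
  by rewrite /prediction_set /= q1 ?leey// ltrDl oppr_gt0.
(* For a level above 1, [1 - alpha i w] is negative, so the threshold is [-oo], below every real
   score. *)
- move=> i i1 a0; rewrite /err indicE mem_set//=.
  have [_ q0 _] := hQ w i1.
  by rewrite /prediction_set /= q0 ?subr_lt0.
- by move=> i i1; exact: arec.
Qed.

Lemma aci_mean_err_cvg (w : T) :
  mean_err C Y alpha N w @[N --> \oo] --> target.
Proof.
apply: (@cvg_dist_le_div_nat _ _ _
  ((Num.max alpha1 (1 - alpha1) + gamma) / gamma)) => N N1.
rewrite (le_trans (aci_mean_err_bound w N1))// invfM mulrA mulrAC.
exact: lexx.
Qed.

End OneSidedACI.

Theorem proposition2 (R : realType) (d : measure_display)
    (T : measurableType d) (P : probability T R) (p n0 : nat)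
    (X0 : 'I_n0 -> {RV P >-> p.-tuple R}) (Y0 : 'I_n0 -> {RV P >-> R})
    (X : nat -> {RV P >-> p.-tuple R}) (Y : nat -> {RV P >-> R})
    (sL sU : score_rule R p) (QL QU : quantile_rule R p)
    (past : nat -> T -> seq (observation R p))
    (hpast : past = past_data (fun k => X0 k) (fun k => Y0 k)
                              (fun i => X i) (fun i => Y i))
    (CL CU : nat -> T -> R -> set R)
    (hCL : CL = prediction_set sL QL past (fun i => X i))
    (hCU : CU = prediction_set sU QU past (fun i => X i))
    (hCL_interval : forall (i : nat) (w : T) (a : R), (1 <= i)%N ->
       lower_bounded_interval (CL i w a))
    (hCU_interval : forall (i : nat) (w : T) (a : R), (1 <= i)%N ->
       upper_bounded_interval (CU i w a))
    (hQL : forall (i : nat) (w : T), (1 <= i)%N ->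
       quantile_convention (QL i (past i w)))
    (hQU : forall (i : nat) (w : T), (1 <= i)%N ->
       quantile_convention (QU i (past i w)))
    (gamma targetL targetU alpha1L alpha1U : R)
    (hgamma : 0 < gamma)
    (htargetL : 0 < targetL < 1) (htargetU : 0 < targetU < 1)
    (halpha1L : 0 <= alpha1L <= 1) (halpha1U : 0 <= alpha1U <= 1)
    (alphaL alphaU : nat -> T -> R)
    (hrecL : aci_recursion CL (fun i => Y i) targetL gamma alpha1L alphaL)
    (hrecU : aci_recursion CU (fun i => Y i) targetU gamma alpha1U alphaU) :
  ({ae P, forall w, forall N : nat, (1 <= N)%N ->
      `|mean_err CL (fun i => Y i) alphaL N w - targetL| <=
      (Num.max alpha1L (1 - alpha1L) + gamma) / (N%:R * gamma)} /\
   {ae P, forall w, forall N : nat, (1 <= N)%N ->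
      `|mean_err CU (fun i => Y i) alphaU N w - targetU| <=
      (Num.max alpha1U (1 - alpha1U) + gamma) / (N%:R * gamma)}) /\
  ({ae P, forall w,
      mean_err CL (fun i => Y i) alphaL N w @[N --> \oo] --> targetL} /\
   {ae P, forall w,
      mean_err CU (fun i => Y i) alphaU N w @[N --> \oo] --> targetU}).
Proof.
(* All four claims hold at every sample point, hence almost surely, whatever the law of the data. *)
subst CL CU; split; split; apply: aeW => w.
- by move=> N; exact: (aci_mean_err_bound hQL hgamma htargetL halpha1L hrecL).
- by move=> N; exact: (aci_mean_err_bound hQU hgamma htargetU halpha1U hrecU).
- exact: (aci_mean_err_cvg hQL hgamma htargetL halpha1L hrecL).
- exact: (aci_mean_err_cvg hQU hgamma htargetU halpha1U hrecU).
Qed.
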